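(* Let $\Phi$ be a simple point process on $\mathbb{R}^d$ with locally bounded intensity measure $\alpha$, and let $f\ge 0$ be a (measurable) function on $\mathbb{R}^d$. If $\Phi$ is $\alpha$-weakly sub-Poisson, then $$\mathbf{E}\exp\left(\int_{\mathbb{R}^d}f(x)\,\Phi(\mathrm{d}x)\right)\le\exp\left(\int_{\mathbb{R}^d}\bigl(e^{f(x)}-1\bigr)\,\alpha(\mathrm{d}x)\right).$$ If $\Phi$ is $\alpha$-weakly super-Poisson, then the reversed inequality is true.
   Context: The intensity measure of $\Phi$ is $\alpha(B)=\mathbf{E}\Phi(B)$; locally bounded means finite on bounded Borel sets. For a simple point process $\Phi$, the $k$-th order factorial moment measure $\alpha^{(k)}$ is the measure on $(\mathbb{R}^d)^k$ obtained by restricting the $k$-th moment measure, determined by $\alpha^k(B_1\times\cdots\times B_k)=\mathbf{E}\prod_{i=1}^k\Phi(B_i)$, to $\{(x_1,\ldots,x_k): x_i\ne x_j \text{ for } i\ne j\}$, i.e. it is the mean measure of the point process of ordered $k$-tuples of distinct points of $\Phi$. The Poisson point process with intensity measure $\alpha$ has factorial moment measures $\alpha^{\otimes k}$. The process $\Phi$ is called $\alpha$-weakly sub-Poisson (respectively $\alpha$-weakly super-Poisson) if for all $k\ge1$ its factorial moment measures are smaller (respectively larger) than those of the Poisson point process with the same intensity measure: $\alpha^{(k)}\le\alpha^{\otimes k}$ (respectively $\alpha^{(k)}\ge\alpha^{\otimes k}$) on Borel sets. Both sides of the inequality may be $+\infty$. *)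

(* Defs.v *)
From HB Require Import structures.
From mathcomp Require Import all_boot all_order all_algebra.
From mathcomp Require Import all_classical all_reals all_analysis.
From mathcomp Require Import measurable_realfun.

Set Implicit Arguments.
Unset Strict Implicit.
Unset Printing Implicit Defensive.
Import Order.TTheory GRing.Theory Num.Theory.
Import numFieldNormedType.Exports.

Local Open Scope classical_set_scope.
Local Open Scope ring_scope.
Local Open Scope ereal_scope.

(* R^d with its Borel sigma-algebra. The carrier is convertible to 'rV[R]_d,
   from which it takes its norm. *)
Notation borel_space R d := (g_sigma_algebraType (@open 'rV[R]_d)).

Section powers.
Context {disp : measure_display} {T : measurableType disp} {R : realType}.
Variable mu : {measure set T -> \bar R}.

(* The k-fold product of mu with itself, on T^k with the product sigma-algebra.
   It is the usual product measure when mu is sigma-finite. *)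
Fixpoint power_measure (k : nat) : set (k.-tuple T) -> \bar R :=
  match k return set (k.-tuple T) -> \bar R with
  | 0%N => \d_[tuple]
  | k'.+1 => fun A =>
      (mu \x @power_measure k') [set p : T * k'.-tuple T | A [tuple of p.1 :: p.2]]
  end.

Lemma power_measure_set0 (k : nat) : @power_measure k set0 = 0.
Proof.
elim: k => [|k IH] /=; first by rewrite measure0.
rewrite /product_measure1 integral0_eq// => x _ /=.
by rewrite [X in power_measure X](_ : _ = set0)//; apply/seteqP; split=> t;
  rewrite /xsection/= inE.
Qed.

Lemma power_measure_ge0 (k : nat) A : 0 <= @power_measure k A.
Proof.
by elim: k A => [|k IH] A //=; apply: integral_ge0 => x _; exact: IH.
Qed.

Lemma power_measure_box (k : nat) (B : 'I_k -> set T) :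
  (forall i, measurable (B i)) ->
  power_measure [set t : k.-tuple T | forall i, B i (tnth t i)] =
  \prod_(i < k) mu (B i).
Proof.
elim: k B => [|k IH] B mB /=.
  by rewrite big_ord0 diracE mem_set// => -[].
rewrite big_ord_recl -IH; last by move=> i; exact: mB.
set c := power_measure _.
rewrite /product_measure1.
transitivity (\int[mu]_x (c * (\1_(B ord0) x)%:E)).
  apply: eq_integral => x _ /=; rewrite indicE.
  have [xB|xB] := boolP (x \in B ord0).
    rewrite mule1; congr power_measure; apply/seteqP; split=> t.
      rewrite /xsection/= inE/= => tB i.
      by have := tB (lift ord0 i); rewrite tnthS.
    move=> tB; rewrite /xsection/= inE/= => i.
    case: (unliftP ord0 i) => [j ->|->]; first by rewrite tnthS; exact: tB.
    by rewrite tnth0; rewrite inE in xB.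
  rewrite mule0 [X in power_measure X](_ : _ = set0) ?power_measure_set0//.
  apply/seteqP; split=> t //; rewrite /xsection/= inE/= => /(_ ord0).
  by rewrite tnth0 => Bx; move: xB; rewrite notin_setE.
rewrite ge0_integralZl//; last 2 first.
- by apply/measurable_EFinP; exact: measurable_indic.
- exact: power_measure_ge0.
by rewrite integral_indic// setIT muleC.
Qed.

End powers.

Section intensity.
Context {dO dT : measure_display} {Omega : measurableType dO}
  {T : measurableType dT} {R : realType}.
Variables (P : probability Omega R) (Phi : R.-ker Omega ~> T).

Definition intensity (B : set T) : \bar R := \int[P]_w Phi w B.

Let intensity0 : intensity set0 = 0.
Proof. by rewrite /intensity integral0_eq. Qed.

Let intensity_ge0 B : 0 <= intensity B.
Proof. by apply: integral_ge0. Qed.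

Let intensity_sigma_additive : semi_sigma_additive intensity.
Proof.
move=> F mF tF mUF.
rewrite [X in _ --> X](_ : _ = \sum_(n <oo) intensity (F n)).
  by apply/cvg_closeP; split; [exact: is_cvg_nneseries|rewrite closeE].
rewrite -integral_nneseries//; last first.
  by move=> n; exact: measurable_kernel.
apply: eq_integral => w _; apply/esym/cvg_lim => //=.
exact: measure_semi_sigma_additive.
Qed.

HB.instance Definition _ := isMeasure.Build _ _ _ intensity
  intensity0 intensity_ge0 intensity_sigma_additive.

End intensity.

Section factorial_moments.
Context {dO dT : measure_display} {Omega : measurableType dO}
  {T : measurableType dT} {R : realType}.
Variables (P : probability Omega R) (Phi : R.-ker Omega ~> T).

Definition moment_measure (k : nat) (A : set (k.-tuple T)) : \bar R :=
  \int[P]_w power_measure (Phi w) A.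

Lemma moment_measure_box (k : nat) (B : 'I_k -> set T) :
  (forall i, measurable (B i)) ->
  moment_measure [set t : k.-tuple T | forall i, B i (tnth t i)] =
  \int[P]_w \prod_(i < k) Phi w (B i).
Proof.
by move=> mB; apply: eq_integral => w _; rewrite power_measure_box.
Qed.

Definition off_diagonal (k : nat) : set (k.-tuple T) :=
  [set t | forall i j, i != j -> tnth t i <> tnth t j].

Definition factorial_moment_measure (k : nat) (A : set (k.-tuple T)) : \bar R :=
  moment_measure (A `&` @off_diagonal k).

Definition alpha_weakly_sub_poisson :=
  forall k, (1 <= k)%N -> forall A : set (k.-tuple T), measurable A ->
    factorial_moment_measure A <= power_measure (intensity P Phi) A.

Definition alpha_weakly_super_poisson :=
  forall k, (1 <= k)%N -> forall A : set (k.-tuple T), measurable A ->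
    power_measure (intensity P Phi) A <= factorial_moment_measure A.

End factorial_moments.

Section point_processes.
Context {R : realType} {d : nat} {dO : measure_display}
  {Omega : measurableType dO}.

Definition locally_bounded (mu : set (borel_space R d) -> \bar R) :=
  forall B : set (borel_space R d), measurable B ->
    bounded_set (B : set 'rV[R]_d) -> mu B < +oo.

(* Integer-valued and finite on bounded Borel sets. *)
Definition locally_finite_counting (mu : set (borel_space R d) -> \bar R) :=
  forall B : set (borel_space R d), measurable B ->
    bounded_set (B : set 'rV[R]_d) -> exists n : nat, mu B = n%:R%:E.

(* A random element of the space of locally finite counting measures: being a
   kernel says that each Phi(B) is a random variable. *)
Definition point_process (Phi : R.-ker Omega ~> borel_space R d) :=
  forall w, locally_finite_counting (Phi w).

Definition simple_point_process (P : probability Omega R)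
    (Phi : R.-ker Omega ~> borel_space R d) :=
  point_process Phi /\ {ae P, forall w, forall x, Phi w [set x] <= 1}.

End point_processes.

(* Main.v *)
Require Import Defs.
From HB Require Import structures.
From mathcomp Require Import all_boot all_order all_algebra.
From mathcomp Require Import all_classical all_reals all_analysis.
From mathcomp Require Import measurable_realfun.

From mathcomp Require Import ring lra.

Set Implicit Arguments.
Unset Strict Implicit.
Unset Printing Implicit Defensive.
Import Order.TTheory GRing.Theory Num.Theory.
Import numFieldNormedType.Exports.

Local Open Scope classical_set_scope.
Local Open Scope ring_scope.
Local Open Scope ereal_scope.

(** Write [g = e^f - 1].  If [f] is a step function, equal to [r i >= 0] on
    finitely many disjoint bounded Borel sets [A i] and to [0] elsewhere, and
    [N i = Phi (A i)], the binomial theorem gives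
      [exp (\int f dPhi) = \prod_i (1 + g i) ^ N i
                         = \prod_i \sum_n g i ^ n / n! * N i ^_ n]
    with falling factorials [N i ^_ n = N i (N i - 1) ... (N i - n + 1)],
    whereas, with [a i = alpha (A i)],
      [exp (\int g dalpha) = \prod_i \sum_n g i ^ n / n! * a i ^ n].
    All terms are nonnegative, so both products of series may be expanded and
    integrated term by term, and it is enough to compare, for every family of
    exponents [n i], the mean of the product of the falling factorials
    [N i ^_ (n i)] with the product of the powers [a i ^ n i]
    ([cmpe_integral_prod_nneseries]).  These are the masses that the factorial
    moment measure and the power of [alpha] give to one and the same box, a
    product of copies of the sets [A i] in which [A i] occurs [n i] times: this
    is the hypothesis.  Monotone convergence along step functions increasing to
    [f] finishes the proof ([cmpe_exp_moment]).

    The identification of the factorial moments of boxes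
    ([power_measure_colored_box_off_diagonal]) goes by induction on the number
    of factors: choosing a point [x] in the first factor [A i] leaves the box in
    which [A i] is replaced by [A i] minus [x].  This lowers the count of [A i]
    by exactly one only if [x] is an atom of mass one, so the argument needs
    almost every point of a simple integer-valued measure to be such an atom.  That
    holds because [R^d] has a countable family of Borel sets separating its
    points: halving a set of positive mass along the family, always keeping a
    half of positive mass, one never goes below mass one, and only one point is
    left in the limit ([integer_valued_atom]).

    The sub-Poisson and the super-Poisson statement are the same proof with the
    inequality reversed; a boolean carries its direction. *)

(** * Inequalities in a variable direction, exponential series, integrals *)

Section comparison.
Context {R : realType}.
Implicit Types (x y : \bar R) (u v : nat -> \bar R).

(** The direction of the inequality is a variable, so that the sub-Poisson and
    the super-Poisson case share one proof: all it needs is stability under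
    nonnegative scaling, nonnegative series and limits. *)
Definition cmpe (b : bool) x y := if b then x <= y else y <= x.

Lemma cmpe_refl b x : cmpe b x x.
Proof. by case: b => /=. Qed.

Lemma cmpe_wpM2l b (c : R) x y : (0 <= c)%R ->
  cmpe b x y -> cmpe b (c%:E * x) (c%:E * y).
Proof. by move=> c0; case: b => xy; apply: lee_wpmul2l. Qed.

Lemma cmpe_lim b u v l l' :
  u @ \oo --> l -> v @ \oo --> l' -> (forall n, cmpe b (u n) (v n)) ->
  cmpe b l l'.
Proof.
move=> ul vl uv; rewrite -(cvg_lim _ ul)// -(cvg_lim _ vl)//.
case: b uv => uv; apply: lee_lim; (try by apply/cvg_ex; eexists; eassumption);
  exact: nearW.
Qed.

Lemma cmpe_nneseries b u v : (forall n, 0 <= u n) -> (forall n, 0 <= v n) ->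
  (forall n, cmpe b (u n) (v n)) ->
  cmpe b (\sum_(n <oo) u n) (\sum_(n <oo) v n).
Proof.
by move=> u0 v0; case: b => uv; apply: lee_nneseries => // n _; exact: uv.
Qed.

End comparison.

Section exponentials.
Context {R : realType}.

Lemma expR_nneseries (x : R) : (0 <= x)%R ->
  (expR x)%:E = \sum_(n <oo) (x ^+ n / n`!%:R)%:E.
Proof.
move=> x0; rewrite /expR -EFin_lim; last exact: is_cvg_series_exp_coeff.
by congr (limn _); apply/funext => n /=; rewrite -sumEFin.
Qed.

(** The binomial theorem written as an infinite series, whose terms beyond [N]
    vanish with the falling factorial, so that it can be compared termwise with
    the exponential series. *)
Lemma exprD1_nneseries (g : R) (N : nat) : (0 <= g)%R ->
  ((1 + g) ^+ N)%:E = \sum_(n <oo) (g ^+ n / n`!%:R * (N ^_ n)%:R)%:E.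
Proof.
move=> g0; rewrite (nneseries_split _ N.+1); last first.
  by move=> k _; rewrite lee_fin mulr_ge0// divr_ge0// exprn_ge0.
rewrite [X in _ + X]eseries0 ?adde0; last first.
  by move=> k; rewrite add0n => Nk _; rewrite ffact_small// mulr0.
rewrite add0n big_mkord exprDn sumEFin; congr _%:E.
apply: eq_bigr => i _; rewrite expr1n mul1r -bin_ffact natrM.
by rewrite -mulr_natr; field; rewrite pnatr_eq0 -lt0n fact_gt0.
Qed.

(** Monotonicity of [u] reduces the claim to a supremum, and [expeR] is an
    increasing bijection onto the nonnegative extended reals; this covers limits
    equal to [+oo] as well. *)
Lemma cvg_expeR (u : nat -> \bar R) (l : \bar R) :
  {homo u : m n / (m <= n)%N >-> m <= n} ->
  u @ \oo --> l -> expeR (u n) @[n --> \oo] --> expeR l.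
Proof.
move=> ndu ul.
have -> : l = ereal_sup (range u).
  by apply: cvg_unique ul (ereal_nondecreasing_cvgn ndu).
have nde : {homo (expeR \o u) : m n / (m <= n)%N >-> m <= n}.
  by move=> m n mn /=; rewrite lee_expeR ndu.
have := ereal_nondecreasing_cvgn nde.
rewrite [X in _ --> X -> _](_ : _ = expeR (ereal_sup (range u)))//.
apply/eqP; rewrite eq_le; apply/andP; split.
  apply: ge_ereal_sup => _ [n _ <-] /=; rewrite lee_expeR.
  by apply: ereal_sup_ubound; exists n.
(* The supremum of the exponentials is the exponential of some [y], which
   bounds the sequence [u]. *)
have /expeR_total[y yE] : 0 <= ereal_sup (range (expeR \o u)).
  by apply: le_trans (expeR_ge0 (u 0%N)) _; apply: ereal_sup_ubound; exists 0%N.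
rewrite -yE lee_expeR; apply: ge_ereal_sup => _ [n _ <-].
by rewrite -lee_expeR yE; apply: ereal_sup_ubound; exists n.
Qed.

End exponentials.

Section integrals.
Context d (T : measurableType d) (R : realType).
Variable mu : {measure set T -> \bar R}.

(** The integral of a nonnegative function is a supremum over the simple
    functions below it, hence monotone even for non-measurable functions. *)
Lemma le_integral_pointwise (f g : T -> \bar R) :
  (forall x, 0 <= f x) -> (forall x, f x <= g x) ->
  \int[mu]_x f x <= \int[mu]_x g x.
Proof.
move=> f0 fg; have g0 x : 0 <= g x by exact: le_trans (fg x).
rewrite !ge0_integralTE//; apply: ge_ereal_sup => _ [h hf <-].
by apply: ereal_sup_ubound; exists h => // x; exact: le_trans (fg x).
Qed.

(** Needed because a point process is simple only almost surely: on the
    exceptional event nothing is known about the measurability of the mass that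
    its off-diagonal power gives to a box.  The function [f] is squeezed between
    [g] set to [0] and [g] set to [+oo] on a measurable null set. *)
Lemma ae_eq_integral_measurable_r (f g : T -> \bar R) :
  (forall x, 0 <= f x) -> (forall x, 0 <= g x) -> measurable_fun setT g ->
  {ae mu, forall x, f x = g x} -> \int[mu]_x f x = \int[mu]_x g x.
Proof.
move=> f0 g0 mg [N [mN N0 fgN]].
have fgE x : x \notin N -> f x = g x.
  by rewrite notin_setE => Nx; apply: contrapT => fg; exact/Nx/fgN.
pose h0 := (g \_ (~` N)).
pose h1 x := h0 x + (cst +oo \_ N) x.
have mh0 : measurable_fun setT h0.
  apply/(measurable_restrictT _ _).1; first exact: measurableC.
  exact: measurable_funTS.
have mh1 : measurable_fun setT h1.
  apply: emeasurable_funD => //.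
  exact/(measurable_restrictT _ _).1.
have h00 x : 0 <= h0 x by rewrite /h0 patchE; case: ifP.
have h10 x : 0 <= h1 x.
  by apply: adde_ge0 => //; rewrite patchE; case: ifP => _ /=; rewrite ?leey.
have gh (h : T -> \bar R) : (forall x, 0 <= h x) -> measurable_fun setT h ->
    (forall x, x \notin N -> h x = g x) -> \int[mu]_x h x = \int[mu]_x g x.
  move=> hge mh hgN; apply: ge0_ae_eq_integral => //.
  exists N; split => // x /= hgx; apply: contrapT => Nx; apply: hgx => _.
  by apply: hgN; rewrite notin_setE.
apply/eqP; rewrite eq_le; apply/andP; split.
- rewrite -(gh h1)//; last first.
    move=> x Nx; rewrite /h1 /h0 !patchE in_setC Nx (negbTE Nx)/= adde0//.
  apply: le_integral_pointwise => // x; rewrite /h1 /h0 !patchE in_setC.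
  by have [Nx|Nx] /= := boolP (x \in N); rewrite ?leey// ?adde0 ?fgE.
- rewrite -(gh h0)//; last by move=> x Nx; rewrite /h0 patchE in_setC Nx.
  apply: le_integral_pointwise => // x; rewrite /h0 patchE in_setC.
  by have [Nx|Nx] /= := boolP (x \in N); rewrite ?f0// fgE.
Qed.

(** Expanding a product of series under the integral sign.  The induction on [s]
    turns one factor at a time from a single term into its series; the factors
    already expanded are absorbed in the weight [W], and their counterpart in
    [c]. *)
Lemma cmpe_integral_prod_nneseries b (J : eqType) (s : seq J)
    (u : J -> nat -> T -> R) (v : J -> nat -> R) (U : J -> T -> R) (V : J -> R)
    (W : T -> R) (c : R) : uniq s ->
  (forall j n x, 0 <= u j n x)%R -> (forall j n, 0 <= v j n)%R ->
  (forall x, 0 <= W x)%R -> (0 <= c)%R ->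
  (forall j n, measurable_fun setT (u j n)) -> measurable_fun setT W ->
  (forall j, measurable_fun setT (U j)) ->
  (forall j x, (U j x)%:E = \sum_(n <oo) (u j n x)%:E) ->
  (forall j, (V j)%:E = \sum_(n <oo) (v j n)%:E) ->
  (forall n : J -> nat,
    cmpe b (\int[mu]_x (W x * \prod_(j <- s) u j (n j) x)%:E)
           (c * \prod_(j <- s) v j (n j))%:E) ->
  cmpe b (\int[mu]_x (W x * \prod_(j <- s) U j x)%:E)
         (c * \prod_(j <- s) V j)%:E.
Proof.
move=> + u0 v0 + + mu_ + mU UE VE.
have U0 j x : (0 <= U j x)%R.
  by rewrite -lee_fin UE nneseries_ge0// => n _ _; rewrite lee_fin.
have V0 j : (0 <= V j)%R.
  by rewrite -lee_fin VE nneseries_ge0// => n _ _; rewrite lee_fin.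
elim: s W c => [|j s IH] W c + W0 c0 mW H.
  move=> _; have := H (fun=> 0%N); rewrite !big_nil.
  under eq_integral do rewrite big_nil.
  by under [X in _ -> cmpe _ X _]eq_integral do rewrite big_nil.
move=> /= /andP[js us]; rewrite big_cons mulrA.
under eq_integral do rewrite big_cons mulrA.
apply: IH => //; first by move=> x; rewrite mulr_ge0.
- by rewrite mulr_ge0.
- exact: measurable_funM.
move=> n.
have -> : (c * V j * \prod_(i <- s) v i (n i))%:E =
    \sum_(k <oo) (c * (v j k * \prod_(i <- s) v i (n i)))%:E.
  rewrite mulrAC EFinM VE -nneseriesZl; last by move=> k _; rewrite lee_fin.
  by apply: eq_eseriesr => k _; rewrite -EFinM; congr _%:E; ring.
have -> : \int[mu]_x (W x * U j x * \prod_(i <- s) u i (n i) x)%:E =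
   \sum_(k <oo) \int[mu]_x (W x * (u j k x * \prod_(i <- s) u i (n i) x))%:E.
  rewrite -integral_nneseries//; last 2 first.
  - move=> k; apply/measurable_EFinP/measurable_funM => //.
    by apply: measurable_funM => //; apply: measurable_prod => i _.
  - by move=> k x _; rewrite lee_fin !mulr_ge0// prodr_ge0.
  apply: eq_integral => x _; rewrite mulrAC EFinM UE -nneseriesZl; last first.
    by move=> k _; rewrite lee_fin.
  by apply: eq_eseriesr => k _; rewrite -EFinM; congr _%:E; ring.
apply: cmpe_nneseries.
- move=> k; apply: integral_ge0 => x _.
  by rewrite lee_fin !mulr_ge0// prodr_ge0.
- by move=> k; rewrite lee_fin !mulr_ge0// prodr_ge0.
(* The exponent of [j] is free in the hypothesis: [j] does not occur in [s]. *)
move=> k; have := H (fun i => if i == j then k else n i).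
rewrite big_cons eqxx.
under eq_integral do rewrite big_cons eqxx.
have ns i : i \in s -> (i == j) = false.
  by move=> si; apply/eqP => ij; rewrite -ij si in js.
rewrite (eq_big_seq (fun i => v i (n i))); last by move=> i /ns ->.
under eq_integral => x _.
  rewrite (eq_big_seq (fun i => u i (n i) x)); last by move=> i /ns ->.
  over.
by [].
Qed.

End integrals.

(** * Atoms of integer-valued measures *)

Section atoms.
Context d (T : measurableType d) (R : realType).
Variable mu : {measure set T -> \bar R}.
Variable U : nat -> set T.
Hypothesis mU : forall n, measurable (U n).
Hypothesis sepU : forall x y, (forall n, U n x <-> U n y) -> x = y.

Definition integer_valued_on (A : set T) :=
  forall B, measurable B -> B `<=` A -> exists n : nat, mu B = n%:R%:E.

Lemma integer_valued_onS (A B : set T) : B `<=` A ->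
  integer_valued_on A -> integer_valued_on B.
Proof. by move=> BA iA C mC CB; apply: iA => //; exact: subset_trans BA. Qed.

Lemma set1_bigcap_separating (x : T) :
  [set x] = \bigcap_n (if `[<U n x>] then U n else ~` U n).
Proof.
apply/seteqP; split => [y -> n _|y Hy].
  by case: ifPn => /asboolP.
apply/sepU => n; have := Hy n Logic.I.
by case: ifPn => /asboolP; split.
Qed.

Lemma measurable_set1_separating (x : T) : measurable [set x].
Proof.
rewrite set1_bigcap_separating; apply: bigcapT_measurable => n.
by case: ifP => _ //; exact: measurableC.
Qed.

(** Bisecting [A] successively by the sets [U n], and always keeping a part of
    nonzero mass, gives a decreasing sequence of sets of mass at least one.  Its
    intersection still has mass at least one, so it is not empty, and it has at
    most one point since every [U n] has been used. *)
Lemma integer_valued_atom (A : set T) : measurable A -> integer_valued_on A ->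
  mu A != 0 -> exists2 x, A x & mu [set x] != 0.
Proof.
move=> mA iA A0.
pose step (B : set T) n :=
  if mu (B `&` U n) == 0 then B `\` U n else B `&` U n.
pose F := fix F n := if n is n'.+1 then step (F n') n' else A.
have FS n : F n.+1 = step (F n) n by [].
have mF n : measurable (F n).
  elim: n => // n IH; rewrite FS /step; case: ifP => _.
    exact: measurableD.
  exact: measurableI.
have Fsub n : F n.+1 `<=` F n.
  by rewrite FS /step; case: ifP => _ x [].
have niF : nonincreasing_seq F.
  by apply/nonincreasing_seqP => n; apply/subsetPset; exact: Fsub.
have FA n : F n `<=` A by have /subsetPset := niF 0%N n (leq0n n).
have F0 n : mu (F n) != 0.
  elim: n => // n IH; rewrite FS /step; case: ifPn => // /eqP FU0.
  apply: contra IH => /eqP FD0; rewrite -(setUIDK (F n) (U n)) .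
  by rewrite measureU0 ?FU0//; [exact: measurableI|exact: measurableD].
have Fge1 n : 1 <= mu (F n).
  have [k Fk] := iA _ (mF n) (FA n).
  have := F0 n; rewrite Fk eqe lee_fin ler1n.
  by rewrite pnatr_eq0 lt0n.
pose G := \bigcap_n F n.
have mG : measurable G by exact: bigcapT_measurable.
have G1 : 1 <= mu G.
  have cvgF : mu \o F @ \oo --> mu G.
    apply: nonincreasing_cvg_mu => //.
    by have [k ->] := iA _ mA (@subset_refl _ A); rewrite ltry.
  rewrite -(cvg_lim _ cvgF)//; apply: lime_ge.
    by apply/cvg_ex; eexists; exact: cvgF.
  exact: nearW.
have [x Gx] : G !=set0.
  by apply/set0P/eqP => G0; move: G1; rewrite G0 measure0 lee_fin ler10.
have GE : G = [set x].
  apply/seteqP; split => [y Gy|y -> //]; apply: sepU => n.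
  have := Gy n.+1 Logic.I; have := Gx n.+1 Logic.I.
  rewrite FS /step; case: ifP => _ [_ Ux] [_ Uy]; split => //.
exists x; first exact: FA (Gx 0%N Logic.I).
by rewrite -GE; apply/eqP => G0; move: G1; rewrite G0 lee_fin ler10.
Qed.

Definition unit_atoms (A : set T) := [set x | A x /\ mu [set x] = 1].

(** Removing one atom lowers the mass by one, so after [mu A] steps no mass is
    left.  This also exhibits [unit_atoms mu A] as a finite set, whence its
    measurability. *)
Lemma integer_valued_mass_unit_atoms (A : set T) : measurable A ->
  integer_valued_on A -> (forall x, mu [set x] <= 1) ->
  measurable (unit_atoms A) /\ mu (A `\` unit_atoms A) = 0.
Proof.
move=> + + le1; have mset1 := measurable_set1_separating.
move=> mA iA; have [N] := iA _ mA (@subset_refl _ A).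
elim: N A mA iA => [|N IH] A mA iA AN.
  have -> : unit_atoms A = set0.
    apply/seteqP; split => // x [Ax x1].
    have : mu [set x] <= mu A by apply: le_measure; rewrite ?inE// => y ->.
    by rewrite x1 AN lee_fin ler10.
  by split; rewrite ?setD0.
have [|x Ax x0] := integer_valued_atom mA iA; first by rewrite AN.
have x1 : mu [set x] = 1.
  have [[|[|k]] kE] := iA [set x] (mset1 x) (ltac:(by move=> y ->)).
  - by rewrite kE eqxx in x0.
  - by [].
  - by have := le1 x; rewrite kE lee_fin lern1.
have mD : measurable (A `\ x) by exact: measurableD.
have iD : integer_valued_on (A `\ x) by apply: integer_valued_onS iA => y [].
have [|mDu Du0] := IH _ mD iD.
  have Ax1 : A `&` [set x] = [set x] by rewrite setIidr// => y ->.
  have Afin : mu A < +oo by rewrite AN ltry.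
  have -> : mu (A `\ x) = mu A - mu (A `&` [set x]) by exact: measureD.
  rewrite Ax1.
  by rewrite x1 AN -natr1 EFinD addeK.
have uE : unit_atoms A = unit_atoms (A `\ x) `|` [set x].
  apply/seteqP; split => y.
    move=> [Ay y1]; have [->|/eqP yx] := eqVneq y x; first by right.
    by left.
  by move=> [[[Ay _] y1]//|->].
rewrite uE; split; first exact: measurableU.
by rewrite setUC -setDDl.
Qed.

End atoms.

(** * Off-diagonal mass of boxes *)

Section colored_boxes.
Context d (T : measurableType d) (R : realType) (I : eqType).
Variable U : nat -> set T.
Hypothesis mU : forall n, measurable (U n).
Hypothesis sepU : forall x y, (forall n, U n x <-> U n y) -> x = y.
Implicit Types (A : I -> set T) (c : seq I).

(** A box in a power of [T] whose factors belong to the family [A]; the word [c]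
    tells which member of the family stands at each position, so that the
    multiplicities of the members are counted by [count_mem]. *)
Definition colored_box A c : set ((size c).-tuple T) :=
  [set t | forall i, A (tnth (in_tuple c) i) (tnth t i)].
Arguments colored_box : clear implicits.

Lemma measurable_colored_box A c : (forall i, measurable (A i)) ->
  measurable (colored_box A c).
Proof.
move=> mA.
rewrite (_ : colored_box A c =
  \bigcap_(i in [set: 'I_(size c)])
     ((fun t => tnth t i) @^-1` A (tnth (in_tuple c) i))); last first.
  by apply/seteqP; split => t tA i => [_|]; exact: tA.
apply: fin_bigcap_measurable => // i _.
by rewrite -[X in measurable X]setTI; apply: measurable_tnth.
Qed.

(** Two points are distinct exactly when one of the countably many sets [U n]
    contains one of them and not the other. *)
Lemma measurable_off_diagonal k : measurable (@off_diagonal d T k).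
Proof.
pose V (i : 'I_k) n := (fun t : k.-tuple T => tnth t i) @^-1` U n.
have mV i n : measurable (V i n).
  by rewrite -[X in measurable X]setTI; apply: measurable_tnth.
rewrite (_ : @off_diagonal d T k =
    \bigcap_(p in [set p : 'I_k * 'I_k | p.1 != p.2]) \bigcup_n
      ((V p.1 n `\` V p.2 n) `|` (V p.2 n `\` V p.1 n))); last first.
  apply/seteqP; split => [t tD [i j] /= ij|t tD i j ij tij].
    apply: contrapT => H; apply: (tD _ _ ij); apply: sepU => n.
    split => Un; apply: contrapT => nUn; apply: H; exists n => //.
      by left.
    by right.
  by have [n _ []] := tD (i, j) ij; rewrite /V/= tij => -[].
apply: fin_bigcap_measurable => // -[i j] _; apply: bigcupT_measurable => n.
by apply: measurableU; apply: measurableD.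
Qed.

Lemma off_diagonal_cons k (x : T) (t : k.-tuple T) :
  off_diagonal [tuple of x :: t] <->
  off_diagonal t /\ forall i, tnth t i <> x.
Proof.
split=> [xt|[tD tx] i j].
  split=> [i j ij|i tx].
    by have := xt (lift ord0 i) (lift ord0 j); rewrite !tnthS; apply.
  by have := xt (lift ord0 i) ord0; rewrite tnthS tnth0; apply.
case: (unliftP ord0 i) => [i' ->|->]; case: (unliftP ord0 j) => [j' ->|->].
- by rewrite !tnthS (inj_eq lift_inj); exact: tD.
- by rewrite tnthS tnth0 => _; exact: tx.
- by rewrite tnthS tnth0 => _; apply: nesym; exact: tx.
- by rewrite eqxx.
Qed.

Lemma colored_box_cons A i c (x : T) (t : (size c).-tuple T) :
  colored_box A (i :: c) [tuple of x :: t] <-> A i x /\ colored_box A c t.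
Proof.
have tE j : tnth (in_tuple (i :: c)) (lift ord0 j) = tnth (in_tuple c) j.
  by rewrite !(tnth_nth i).
have t0 : tnth (in_tuple (i :: c)) ord0 = i by rewrite (tnth_nth i).
split=> [xt|[Aix tc] j].
  split; first by have := xt ord0; rewrite t0 tnth0.
  by move=> j; have := xt (lift ord0 j); rewrite tE tnthS.
case: (unliftP ord0 j) => [j' ->|->]; rewrite ?t0 ?tE ?tnth0 ?tnthS //.
Qed.

(** The mass counts the injective choices of points in the factors of the box.
    Once the first point [x] is chosen, in [A i0], the other points are chosen in
    the family with [x] removed, which changes [A i0] only, by disjointness; the
    recursion is that of the falling factorial,
    [N ^_ m.+1 = N * N.-1 ^_ m]. *)
Lemma power_measure_colored_box_off_diagonal (mu : {measure set T -> \bar R})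
    A (N : I -> nat) (s c : seq I) :
  (forall x, mu [set x] <= 1) ->
  (forall i, measurable (A i)) -> (forall i, integer_valued_on mu (A i)) ->
  (forall i j, i != j -> A i `&` A j = set0) ->
  (forall i, mu (A i) = (N i)%:R%:E) ->
  uniq s -> {subset c <= s} ->
  power_measure mu (colored_box A c `&` @off_diagonal d T _) =
  (\prod_(i <- s) ((N i) ^_ (count_mem i c))%:R)%:E.
Proof.
move=> le1 mA iA dA AN us.
elim: c A N mA iA dA AN => [|i0 c IH] A N mA iA dA AN cs.
  rewrite /= diracE mem_set; last by split => -[].
  by rewrite big1// => i _; rewrite ffactn0.
have i0s : i0 \in s by apply: cs; rewrite inE eqxx.
have {}cs : {subset c <= s} by move=> i ic; apply: cs; rewrite inE ic orbT.
have [mD D0] := integer_valued_mass_unit_atoms mU sepU (mA i0) (iA i0) le1.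
set D := unit_atoms mu (A i0) in mD D0.
have mset1 := measurable_set1_separating mU sepU.
(* The mass of a section at [x], where [e] tells whether [x] is a unit atom.
   Almost every point of [A i0] is one, so the value for [e = false] does not
   count in the end. *)
pose val (e : bool) : R :=
  (\prod_(i <- s) ((N i - ((i == i0) && e))%N ^_ (count_mem i c))%:R)%R.
have val0 e : (0 <= val e)%R by apply: prodr_ge0.
have section x : A i0 x ->
    power_measure mu [set t : (size c).-tuple T |
      (colored_box A (i0 :: c) `&` @off_diagonal d T _) [tuple of x :: t]] =
    (val (x \in D))%:E.
  move=> Ax.
  rewrite (_ : [set _ | _] =
      colored_box (fun i => A i `\ x) c `&` @off_diagonal d T _); last first.
    apply/seteqP; split => t /=.
      move=> [/colored_box_cons[_ tc] /off_diagonal_cons[tD tx]].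
      by split => // i; split; [exact: tc|exact: tx].
    move=> [tc tD]; split.
      by apply/colored_box_cons; split => // i; have [] := tc i.
    by apply/off_diagonal_cons; split => // i; have [] := tc i.
  apply: IH => //.
  - by move=> i; exact: measurableD.
  - by move=> i; apply: integer_valued_onS (iA i) => y [].
  - move=> i j ij; apply/seteqP; split => // y [[Ay _] [Ay' _]].
    by rewrite -(dA i j ij).
  move=> i; have [->|ii0] /= := eqVneq i i0; last first.
    rewrite subn0 -AN; congr (mu _); apply/seteqP; split => y; first by case.
    move=> Ay; split => // yx; have : set0 x => //.
    by rewrite -(dA _ _ ii0); split => //; rewrite -yx.
  have Ax1 : A i0 `&` [set x] = [set x] by rewrite setIidr// => y ->.
  have Afin : mu (A i0) < +oo by rewrite AN ltry.
  have -> : mu (A i0 `\ x) = mu (A i0) - mu (A i0 `&` [set x]).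
    exact: measureD.
  rewrite Ax1 AN.
  have [xD|xD] := boolP (x \in D).
    move: (xD); rewrite inE => -[_ x1]; rewrite x1 -EFinB natrB//.
    have : mu [set x] <= mu (A i0) by apply: le_measure; rewrite ?inE// => y ->.
    by rewrite x1 AN lee_fin ler1n.
  have [k kE] := iA i0 [set x] (mset1 x) (ltac:(by move=> y ->)).
  rewrite kE subn0; case: k kE => [|[|k]] kE.
  - by rewrite sube0.
  - by move: xD; rewrite notin_setE => -[]; split.
  - by have := le1 x; rewrite kE lee_fin lern1.
rewrite /= /product_measure1 /=.
rewrite (eq_integral (fun x => (val true)%:E * (\1_D x)%:E
    + (val false)%:E * (\1_(A i0 `\` D) x)%:E)); last first.
  move=> x _; rewrite /= /xsection/=.
  rewrite (_ : [set y | _] = [set t : (size c).-tuple T |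
      (colored_box A (i0 :: c) `&` @off_diagonal d T _) [tuple of x :: t]]);
    last first.
    by apply/seteqP; split => t /=; rewrite inE.
  have [Ax|Ax] := pselect (A i0 x).
    rewrite section// !indicE in_setD (mem_set Ax)/=.
    by case: (x \in D); rewrite /= ?mule0 ?mule1 ?adde0 ?add0e.
  rewrite (_ : [set _ | _] = set0) ?power_measure_set0; last first.
    by apply/seteqP; split => t //= [/colored_box_cons[]].
  have nDx : ~ D x by case.
  by rewrite !indicE in_setD (memNset nDx) (memNset Ax) !mule0 adde0.
have mDc : measurable (A i0 `\` D) by exact: measurableD.
rewrite ge0_integralD//; last 4 first.
- by move=> x _; rewrite -EFinM lee_fin mulr_ge0.
- by apply/measurable_funeM/measurable_EFinP; exact: measurable_indic.
- by move=> x _; rewrite -EFinM lee_fin mulr_ge0.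
- by apply/measurable_funeM/measurable_EFinP; exact: measurable_indic.
rewrite !ge0_integralZl//; last 4 first.
- by apply/measurable_EFinP; exact: measurable_indic.
- by rewrite lee_fin.
- by apply/measurable_EFinP; exact: measurable_indic.
- by rewrite lee_fin.
rewrite !integral_indic// !setIT D0 mule0 adde0.
have -> : mu D = (N i0)%:R%:E.
  have DA : D `<=` A i0 by move=> x [].
  rewrite -AN -[in RHS](setDUK DA).
  have -> : mu (D `|` A i0 `\` D) = mu D + mu (A i0 `\` D).
    by apply: measureU => //; exact: setDIK.
  by rewrite D0 adde0.
rewrite -EFinM /val !(bigD1_seq i0)//= !eqxx/= subn1 add1n ffactnS natrM.
rewrite mulrC mulrA; congr (_ * _)%:E.
apply: eq_bigr => i ii0.
by rewrite (negbTE ii0) eq_sym (negbTE ii0)/= subn0 add0n.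
Qed.

End colored_boxes.
Arguments colored_box {d T I} A c _.

(** * Step functions *)

Section step_functions.
Context {dO dT : measure_display} {Omega : measurableType dO}
  {T : measurableType dT} {R : realType} {I : eqType}.
Variables (P : probability Omega R) (Phi : R.-ker Omega ~> T).
Variable U : nat -> set T.
Hypothesis mU : forall n, measurable (U n).
Hypothesis sepU : forall x y, (forall n, U n x <-> U n y) -> x = y.
Hypothesis simplePhi : {ae P, forall w, forall x, Phi w [set x] <= 1}.
Variables (A : I -> set T) (N : I -> Omega -> nat) (a : I -> R) (s : seq I).
Hypothesis mA : forall i, measurable (A i).
Hypothesis dA : forall i j, i != j -> A i `&` A j = set0.
Hypothesis iA : forall w i, integer_valued_on (Phi w) (A i).
Hypothesis PhiA : forall w i, Phi w (A i) = (N i w)%:R%:E.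
Hypothesis alphaA : forall i, intensity P Phi (A i) = (a i)%:E.
Hypothesis us : uniq s.
Variable b : bool.
Hypothesis weakly_poisson : forall k, (1 <= k)%N ->
  forall B : set (k.-tuple T), measurable B ->
    cmpe b (factorial_moment_measure P Phi B)
           (power_measure (intensity P Phi) B).

(** Over a ring the falling factorial is a polynomial without truncated
    subtraction: for [n < m] the factor of index [n] vanishes.  This form makes
    measurability evident. *)
Lemma ffactr_prod (n m : nat) :
  ((n ^_ m)%:R = \prod_(k < m) (n%:R - k%:R) :> R)%R.
Proof.
elim: m => [|m IH]; first by rewrite ffactn0 big_ord0.
rewrite big_ord_recr /= -IH ffactnSr natrM; have [mn|nm] := leqP m n.
  by rewrite natrB.
by rewrite ffact_small// !mul0r.
Qed.

Lemma measurable_count_natr i : measurable_fun setT (fun w => (N i w)%:R : R).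
Proof.
apply/measurable_EFinP; rewrite (_ : _ \o _ = fun w => Phi w (A i)).
  exact: measurable_kernel.
by apply/funext => w /=; rewrite PhiA.
Qed.

Lemma measurable_count_ffact i m :
  measurable_fun setT (fun w => (N i w ^_ m)%:R : R).
Proof.
under eq_fun do rewrite ffactr_prod.
apply: measurable_prod => k _.
by apply: measurable_funB => //; exact: measurable_count_natr.
Qed.

Lemma factorial_moment_measure_colored_box (c : seq I) : {subset c <= s} ->
  factorial_moment_measure P Phi (colored_box A c) =
  \int[P]_w (\prod_(i <- s) (N i w ^_ (count_mem i c))%:R)%:E.
Proof.
move=> cs; apply: ae_eq_integral_measurable_r.
- by move=> w; exact: power_measure_ge0.
- by move=> w; rewrite lee_fin prodr_ge0.
- apply/measurable_EFinP; apply: measurable_prod => i _.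
  exact: measurable_count_ffact.
apply: filterS simplePhi => w le1.
exact: (power_measure_colored_box_off_diagonal mU sepU).
Qed.

Lemma power_measure_colored_box (c : seq I) :
  power_measure (intensity P Phi) (colored_box A c) = (\prod_(i <- c) a i)%:E.
Proof.
transitivity (\prod_(i < size c) (a (tnth (in_tuple c) i))%:E).
  rewrite -(eq_bigr _ (fun i _ => alphaA (tnth (in_tuple c) i))).
  exact: (power_measure_box _ (fun i => mA (tnth (in_tuple c) i))).
by rewrite prodEFin -(big_tnth _ _ _ xpredT a).
Qed.

(** The hypothesis on factorial moment measures, applied to the box in which
    [A i] occurs [n i] times.  The empty box has to be treated apart, as the
    hypothesis is about positive orders; both sides are then one. *)
Lemma cmpe_joint_factorial_moments (n : I -> nat) :
  cmpe b (\int[P]_w (\prod_(i <- s) (N i w ^_ (n i))%:R)%:E)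
         (\prod_(i <- s) a i ^+ n i)%:E.
Proof.
pose c := flatten [seq nseq (n i) i | i <- s].
have cs : {subset c <= s}.
  by move=> i /flatten_mapP[j js]; rewrite mem_nseq => /andP[_ /eqP ->].
have count_c i : i \in s -> count_mem i c = n i.
  move=> si; rewrite count_flatten -map_comp sumnE big_map (bigD1_seq i)//=.
  rewrite count_nseq/= eqxx mul1n big1 ?addn0// => j ji.
  by rewrite count_nseq/= (negbTE ji).
have alphac : power_measure (intensity P Phi) (colored_box A c) =
    (\prod_(i <- s) a i ^+ n i)%:E.
  rewrite power_measure_colored_box big_flatten big_map; congr _%:E.
  by apply: eq_bigr => i _; rewrite big_nseq iter_mulr_1.
have Phic : factorial_moment_measure P Phi (colored_box A c) =
    \int[P]_w (\prod_(i <- s) (N i w ^_ (n i))%:R)%:E.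
  rewrite factorial_moment_measure_colored_box//; apply: eq_integral => w _.
  by congr _%:E; apply: eq_big_seq => i /count_c ->.
rewrite -alphac -Phic; have [c0|c0] := posnP (size c).
  rewrite factorial_moment_measure_colored_box// power_measure_colored_box.
  rewrite (size0nil c0) big_nil.
  under eq_integral do rewrite big1//.
  by rewrite integral_cst//= mul1e probability_setT; exact: cmpe_refl.
by apply: weakly_poisson => //; exact: measurable_colored_box.
Qed.

Lemma cmpe_exp_moment_counts (g : I -> R) : (forall i, 0 <= g i)%R ->
  cmpe b (\int[P]_w (\prod_(i <- s) (1 + g i) ^+ N i w)%:E)
         (\prod_(i <- s) expR (g i * a i))%:E.
Proof.
move=> g0.
have a0 i : (0 <= a i)%R by rewrite -lee_fin -alphaA.
suff : cmpe b (\int[P]_w (1 * \prod_(i <- s) (1 + g i) ^+ N i w)%:E)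
    (1 * \prod_(i <- s) expR (g i * a i))%:E.
  by rewrite mul1r; under eq_integral do rewrite mul1r.
apply: (@cmpe_integral_prod_nneseries _ _ _ P b _ s
  (fun i n w => g i ^+ n / n`!%:R * (N i w ^_ n)%:R)%R
  (fun i n => (g i * a i) ^+ n / n`!%:R)%R) => //.
- by move=> i n w; rewrite mulr_ge0// divr_ge0// exprn_ge0.
- by move=> i n; rewrite divr_ge0// exprn_ge0// mulr_ge0.
- by move=> i n; apply: measurable_funM => //; exact: measurable_count_ffact.
- move=> i; apply/measurable_EFinP; rewrite /comp.
  under eq_fun do rewrite exprD1_nneseries//.
  apply: ge0_emeasurable_sum => [n w _ _|n _].
    by rewrite lee_fin mulr_ge0// divr_ge0// exprn_ge0.
  apply/measurable_EFinP; apply: measurable_funM => //.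
  exact: measurable_count_ffact.
- by move=> i w; exact: exprD1_nneseries.
- by move=> i; apply: expR_nneseries; rewrite mulr_ge0.
move=> n; pose C := (\prod_(i <- s) (g i ^+ n i / (n i)`!%:R))%R.
have C0 : (0 <= C)%R by apply: prodr_ge0 => i _; rewrite divr_ge0// exprn_ge0.
have -> : (1 * \prod_(i <- s) ((g i * a i) ^+ n i / (n i)`!%:R))%:E =
    C%:E * (\prod_(i <- s) a i ^+ n i)%:E.
  rewrite mul1r -EFinM -big_split/=; congr _%:E; apply: eq_bigr => i _.
  by rewrite exprMn mulrAC.
rewrite (eq_integral (fun w =>
    C%:E * (\prod_(i <- s) (N i w ^_ n i)%:R)%:E)); last first.
  by move=> w _; rewrite mul1r -EFinM -big_split.
rewrite ge0_integralZl//; last 2 first.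
- apply/measurable_EFinP; apply: measurable_prod => i _.
  exact: measurable_count_ffact.
- by move=> w _; rewrite lee_fin prodr_ge0.
by apply: cmpe_wpM2l => //; exact: cmpe_joint_factorial_moments.
Qed.

Definition step_fun (r : I -> R) x : R := (\sum_(i <- s) r i * \1_(A i) x)%R.

Lemma integral_step (mu : {measure set T -> \bar R}) (r : I -> R) (m : I -> R) :
  (forall i, 0 <= r i)%R -> (forall i, mu (A i) = (m i)%:E) ->
  \int[mu]_x (step_fun r x)%:E = (\sum_(i <- s) r i * m i)%:E.
Proof.
move=> r0 mum; rewrite -sumEFin.
under eq_integral do rewrite -sumEFin.
rewrite ge0_integral_sum//; last 2 first.
- move=> i; apply/measurable_EFinP; apply: measurable_funM => //.
- by move=> i x _; rewrite lee_fin mulr_ge0.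
apply: eq_bigr => i _; under eq_integral do rewrite EFinM.
rewrite ge0_integralZl//; last 2 first.
- by apply/measurable_EFinP; exact: measurable_indic.
- by rewrite lee_fin.
by rewrite integral_indic// setIT EFinM mum.
Qed.

(** At each point at most one term of the sum is nonzero. *)
Lemma comp_step (phi : R -> R) (r : I -> R) x : phi 0%R = 0%R ->
  phi (step_fun r x) = step_fun (phi \o r) x.
Proof.
move=> phi0; rewrite /step_fun.
have [[i si Ax]|nA] := pselect (exists2 i, i \in s & A i x).
  rewrite !(bigD1_seq i)//= indicE mem_set// !mulr1.
  have Aj j : j != i -> \1_(A j) x = 0%R :> R.
    move=> ji; rewrite indicE memNset// => Ajx.
    by have : set0 x by rewrite -(dA ji).
  by rewrite !big1 ?addr0// => j /Aj ->; rewrite mulr0.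
rewrite !big_seq !big1 ?phi0// => i si; rewrite indicE memNset ?mulr0// => Ax;
  by apply: nA; exists i.
Qed.

Lemma measurable_exp_integral_step (r : I -> R) : (forall i, 0 <= r i)%R ->
  measurable_fun setT (fun w => expeR (\int[Phi w]_x (step_fun r x)%:E)).
Proof.
move=> r0; under eq_fun do rewrite (integral_step r0 (PhiA _)).
apply/measurable_EFinP; apply: measurableT_comp => //.
apply: measurable_sum => i; apply: measurable_funM => //.
exact: measurable_count_natr.
Qed.

Lemma cmpe_exp_moment_step (r : I -> R) : (forall i, 0 <= r i)%R ->
  cmpe b (\int[P]_w expeR (\int[Phi w]_x (step_fun r x)%:E))
         (expeR (\int[intensity P Phi]_x (expR (step_fun r x) - 1)%:E)).
Proof.
move=> r0; pose g i := (expR (r i) - 1)%R.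
have g0 i : (0 <= g i)%R.
  by have := expR_ge1Dx (r i); have := r0 i; rewrite /g; lra.
under eq_integral => w _.
  rewrite (integral_step r0 (PhiA w)) /= expR_sum.
  under eq_bigr => i _.
    rewrite mulr_natr -mulr_natl expRM_natl.
    rewrite (_ : expR (r i) = 1 + g i)%R; last by rewrite addrC subrK.
    over.
  over.
have -> : \int[intensity P Phi]_x (expR (step_fun r x) - 1)%:E =
    (\sum_(i <- s) g i * a i)%:E.
  rewrite -(integral_step g0 alphaA); apply: eq_integral => x _; congr _%:E.
  by rewrite (comp_step (phi := fun y => expR y - 1)%R)// expR0 subrr.
by rewrite /= expR_sum; exact: cmpe_exp_moment_counts.
Qed.

End step_functions.

(** * Passage to the limit *)

Lemma nondecreasing_cvg_integral d (T : measurableType d) (R : realType)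
    (mu : {measure set T -> \bar R}) (F : nat -> T -> \bar R) (f : T -> \bar R) :
  (forall n, measurable_fun setT (F n)) -> (forall n x, 0 <= F n x) ->
  (forall x, {homo F ^~ x : m n / (m <= n)%N >-> m <= n}) ->
  (forall x, F n x @[n --> \oo] --> f x) ->
  \int[mu]_x F n x @[n --> \oo] --> \int[mu]_x f x.
Proof.
move=> mF F0 ndF Ff.
rewrite (_ : \int[mu]_x f x = \int[mu]_x limn (F ^~ x)); last first.
  by apply: eq_integral => x _; apply/esym/cvg_lim => //; exact: Ff.
by apply: cvg_monotone_convergence => // x _; exact: ndF.
Qed.

Section exponential_moment_comparison.
Import HBNNSimple.
Context {dO dT : measure_display} {Omega : measurableType dO}
  {T : measurableType dT} {R : realType}.
Variables (P : probability Omega R) (Phi : R.-ker Omega ~> T).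
Variables (U K : nat -> set T) (f : T -> R) (b : bool).
Hypothesis mU : forall n, measurable (U n).
Hypothesis sepU : forall x y, (forall n, U n x <-> U n y) -> x = y.
Hypothesis mK : forall n, measurable (K n).
Hypothesis ndK : nondecreasing_seq K.
Hypothesis coverK : \bigcup_n K n = setT.
Hypothesis simplePhi : {ae P, forall w, forall x, Phi w [set x] <= 1}.
Hypothesis PhiK : forall w n, integer_valued_on (Phi w) (K n).
Hypothesis alphaK : forall n, intensity P Phi (K n) < +oo.
Hypothesis weakly_poisson : forall k, (1 <= k)%N ->
  forall B : set (k.-tuple T), measurable B ->
    cmpe b (factorial_moment_measure P Phi B)
           (power_measure (intensity P Phi) B).
Hypothesis f0 : forall x, (0 <= f x)%R.
Hypothesis mf : measurable_fun setT f.

Let mEf : measurable_fun setT (EFin \o f).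
Proof. exact/measurable_EFinP. Qed.

Let h := nnsfun_approx measurableT mEf.
Let A n y := h n @^-1` [set y] `&` K n.
Let s n : seq R := finmap.enum_fset (fset_set (range (h n))).
Let F n x : R := (h n x * \1_(K n) x)%R.

(* The values of [h n] are nonnegative; the norm only makes the coefficient
   nonnegative at every index. *)
Let FE n x : F n x = step_fun (A n) (s n) Num.norm x.
Proof.
have hs : h n x \in s n by rewrite in_fset_set ?inE.
rewrite /step_fun (bigD1_seq (h n x))//= ?finmap.fset_uniq// big1 ?addr0;
  last first.
  move=> y yh; rewrite indicE memNset ?mulr0// => -[/= hy _].
  by rewrite hy eqxx in yh.
rewrite ger0_norm// /F; congr (_ * _)%R.
rewrite !indicE; congr (_%:R); congr nat_of_bool.
by apply/idP/idP; rewrite !inE; [|case].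
Qed.

Let mA n y : measurable (A n y).
Proof. exact: measurableI. Qed.

Let F0 n x : (0 <= F n x)%R.
Proof. by rewrite mulr_ge0. Qed.

Let ndF x : {homo F ^~ x : m n / (m <= n)%N >-> (m <= n)%R}.
Proof.
move=> m n mn; apply: ler_pM => //.
  by have /lefP := nd_nnsfun_approx measurableT mEf mn; exact.
rewrite !indicE ler_nat; have /subsetPset Kmn := ndK mn.
by case: (boolP (x \in K m)) => //; rewrite inE => /Kmn Kx; rewrite mem_set.
Qed.

Let cvgF x : (F n x)%:E @[n --> \oo] --> (f x)%:E.
Proof.
have [N _ KN] : (\bigcup_n K n) x by rewrite coverK.
have := @cvg_nnsfun_approx _ _ _ _ measurableT _ mEf (fun x _ => f0 x) x Logic.I.
apply: cvg_trans; apply: near_eq_cvg; near=> n.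
rewrite /F /= indicE mem_set ?mulr1//.
have Nn : (N <= n)%N by near: n; exact: nbhs_infty_ge.
by have /subsetPset := ndK Nn; apply.
Unshelve. all: by end_near. Qed.

Let mF n : measurable_fun setT (F n).
Proof. by apply: measurable_funM => //; exact: measurable_indic. Qed.

(** The theorem on any measurable space exhausted by sets on which the point
    process is integer-valued and has finite mean, given a countable separating
    family.  Step functions increasing to [f] are obtained by cutting off the
    standard simple approximations of [f] outside [K n]. *)
Lemma cmpe_exp_moment :
  cmpe b (\int[P]_w expeR (\int[Phi w]_x (f x)%:E))
         (expeR (\int[intensity P Phi]_x (expR (f x) - 1)%:E)).
Proof.
have intF (mu : {measure set T -> \bar R}) :
    \int[mu]_x (F n x)%:E @[n --> \oo] --> \int[mu]_x (f x)%:E.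
  apply: nondecreasing_cvg_integral => // n.
  by apply/measurable_EFinP; exact: mF.
have nd_intF (mu : {measure set T -> \bar R}) :
    {homo (fun n => \int[mu]_x (F n x)%:E) : m n / (m <= n)%N >-> m <= n}.
  by move=> m n mn; apply: le_integral_pointwise => x; rewrite lee_fin// ndF.
have PhiA n w y : exists N : nat, Phi w (A n y) = N%:R%:E.
  by apply: (@PhiK w n _ (mA n y)) => x [].
pose N n y w : nat := projT1 (cid (PhiA n w y)).
have NE n w y : Phi w (A n y) = (N n y w)%:R%:E.
  exact: (projT2 (cid (PhiA n w y))).
apply: (@cmpe_lim _ b
  (fun n => \int[P]_w expeR (\int[Phi w]_x (F n x)%:E))
  (fun n => expeR (\int[intensity P Phi]_x (expR (F n x) - 1)%:E))).
- apply: nondecreasing_cvg_integral.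
  + move=> n; under eq_fun do under eq_integral do rewrite FE.
    exact: (measurable_exp_integral_step _ (mA n) (NE n)).
  + by move=> n w; exact: expeR_ge0.
  + by move=> w m n mn; rewrite lee_expeR nd_intF.
  + by move=> w; apply: cvg_expeR => //; exact: nd_intF.
- have e0 n x : (0 <= expR (F n x) - 1)%R.
    by have := expR_ge1Dx (F n x); have := F0 n x; lra.
  have nde x m n : (m <= n)%N -> (expR (F m x) - 1 <= expR (F n x) - 1)%R.
    by move=> mn; rewrite lerD2r ler_expR ndF.
  apply: cvg_expeR.
    move=> m n mn; apply: le_integral_pointwise => x; rewrite lee_fin//.
    exact: nde.
  apply: nondecreasing_cvg_integral.
  + move=> n; apply/measurable_EFinP; apply: measurable_funB => //.
    exact: measurableT_comp.
  + by move=> n x; rewrite lee_fin.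
  + by move=> x m n mn; rewrite lee_fin nde.
  + move=> x; have /fine_cvgP[_ Ff] := @cvgF x.
    apply: cvg_EFin; first exact: nearW.
    apply: cvgB; last exact: cvg_cst.
    by apply: continuous_cvg; [exact: continuous_expR|exact: Ff].
- move=> n.
  rewrite (_ : (fun x => (expR (F n x) - 1)%:E) =
    fun x => (expR (step_fun (A n) (s n) Num.norm x) - 1)%:E); last first.
    by apply/funext => x; rewrite FE.
  under eq_integral do under eq_integral do rewrite FE.
  apply: (@cmpe_exp_moment_step _ _ _ _ _ _ P Phi U mU sepU simplePhi
    (A n) (N n) (fun y => fine (intensity P Phi (A n y)))) => //.
  + move=> y z yz; apply/seteqP; split => // x [[/= hy _] [hz _]].
    by move: yz; rewrite -hy -hz eqxx.
  + by move=> w y; apply: integer_valued_onS (@PhiK w n) => x [].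
  + move=> y; rewrite fineK// ge0_fin_numE//.
    apply: le_lt_trans (alphaK n); apply: le_measure; rewrite ?inE//.
    by move=> x [].
  + exact: finmap.fset_uniq.
Qed.

End exponential_moment_comparison.

(** * Row vectors and conclusion *)

Section row_space.
Context {R : realType} {d : nat}.

Lemma open_measurable_borel_space (A : set 'rV[R]_d) :
  open A -> measurable (A : set (borel_space R d)).
Proof. by move=> oA; exact: sub_sigma_algebra. Qed.

Definition rational_halfspace (n : nat) : set (borel_space R d) :=
  if (unpickle n : option ('I_d * rat)) is Some (i, q)
  then [set x : 'rV[R]_d | (x ord0 i < ratr q)%R] else set0.

Lemma measurable_rational_halfspace n : measurable (rational_halfspace n).
Proof.
rewrite /rational_halfspace; case: unpickle => [[i q]|]//.
apply: open_measurable_borel_space.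
apply: (@open_comp _ _ (fun x : 'rV[R]_d => x ord0 i) [set r | (r < ratr q)%R]).
  by move=> x _; exact: coord_continuous.
exact: open_lt.
Qed.

(** Distinct points differ in some coordinate, and a rational number lies between
    the two values. *)
Lemma rational_halfspace_separating (x y : borel_space R d) :
  (forall n, rational_halfspace n x <-> rational_halfspace n y) -> x = y.
Proof.
have H (u v : 'rV[R]_d) i : (u ord0 i < v ord0 i)%R ->
    ~ (forall n, rational_halfspace n u <-> rational_halfspace n v).
  move=> /rat_in_itvoo[q]; rewrite in_itv/= => /andP[uq qv].
  move=> /(_ (pickle (i, q))); rewrite /rational_halfspace pickleK/= => -[+ _].
  by move=> /(_ uq); rewrite ltNge ltW.
move=> xy; apply/matrixP => i j; rewrite (ord1 i).
apply/eqP; rewrite eq_le !leNgt.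
apply/andP; split; apply/negP => /H; apply => // n.
by apply: iff_sym.
Qed.

Definition centered_ball (n : nat) : set (borel_space R d) :=
  [set x : 'rV[R]_d | (`|x| < n%:R)%R].

Lemma measurable_centered_ball n : measurable (centered_ball n).
Proof.
apply: open_measurable_borel_space.
apply: (@open_comp _ _ (fun x : 'rV[R]_d => `|x|%R) [set r | (r < n%:R)%R]).
  by move=> x _; exact: norm_continuous.
exact: open_lt.
Qed.

Lemma bounded_subset_centered_ball n (B : set (borel_space R d)) :
  B `<=` centered_ball n -> bounded_set (B : set 'rV[R]_d).
Proof.
move=> BK; exists n%:R; split; first exact: num_real.
by move=> M nM x /BK /ltW xn; exact: le_trans xn (ltW nM).
Qed.

Lemma nondecreasing_centered_ball : nondecreasing_seq centered_ball.
Proof.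
move=> m n mn; apply/subsetPset => x /= xm.
by apply: lt_le_trans xm _; rewrite ler_nat.
Qed.

Lemma bigcup_centered_ball : \bigcup_n centered_ball n = setT.
Proof.
apply/seteqP; split => // x _; exists (Num.truncn `|x : 'rV[R]_d|).+1 => //.
exact: truncnS_gt.
Qed.

End row_space.

Lemma cmpe_exp_moment_simple_point_process (R : realType) (d : nat)
  (dO : measure_display) (Omega : measurableType dO) (P : probability Omega R)
  (Phi : R.-ker Omega ~> borel_space R d) (f : borel_space R d -> R) (b : bool) :
  simple_point_process P Phi -> locally_bounded (intensity P Phi) ->
  (forall x, (0 <= f x)%R) -> measurable_fun [set: borel_space R d] f ->
  (forall k, (1 <= k)%N ->
    forall B : set (k.-tuple (borel_space R d)), measurable B ->
    cmpe b (factorial_moment_measure P Phi B)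
           (power_measure (intensity P Phi) B)) ->
  cmpe b (\int[P]_w expeR (\int[Phi w]_x (f x)%:E))
         (expeR (\int[intensity P Phi]_x (expR (f x) - 1)%:E)).
Proof.
move=> [pp simple] lb f0 mf wp.
apply: (cmpe_exp_moment measurable_rational_halfspace
  rational_halfspace_separating measurable_centered_ball
  nondecreasing_centered_ball bigcup_centered_ball) => //.
- move=> w n B mB BK; apply: pp => //; exact: bounded_subset_centered_ball BK.
- move=> n; apply: lb; first exact: measurable_centered_ball.
  exact: (@bounded_subset_centered_ball _ _ n).
Qed.

Theorem proposition2 (R : realType) (d : nat) (dO : measure_display)
  (Omega : measurableType dO) (P : probability Omega R)
  (Phi : R.-ker Omega ~> borel_space R d) (f : borel_space R d -> R)
  (Phi_simple : simple_point_process P Phi)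
  (alpha_locally_bounded : locally_bounded (intensity P Phi))
  (f_ge0 : forall x, (0 <= f x)%R)
  (f_measurable : measurable_fun [set: borel_space R d] f) :
  (alpha_weakly_sub_poisson P Phi ->
    \int[P]_w expeR (\int[Phi w]_x (f x)%:E) <=
    expeR (\int[intensity P Phi]_x (expR (f x) - 1)%:E)) /\
  (alpha_weakly_super_poisson P Phi ->
    expeR (\int[intensity P Phi]_x (expR (f x) - 1)%:E) <=
    \int[P]_w expeR (\int[Phi w]_x (f x)%:E)).
Proof.
split=> H.
  exact: (cmpe_exp_moment_simple_point_process (b := true)).
exact: (cmpe_exp_moment_simple_point_process (b := false)).
Qed.
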